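(* Let $n\ge 1$ and let $f_{1,n}, f_{2,n} : [1]\times[2]\times\cdots\times[n] \to S_n$ be the bijections defined in the context. Then the map $f_{1,n}\circ f_{2,n}^{-1}\circ f_{1,n}\circ f_{2,n}^{-1} : S_n\to S_n$ is the identity.
   Context: Notation: $[m]=\{1,2,\dots,m\}$, and $S_n$ is the set of permutations of $[n]$. A permutation $\sigma$ is identified with its one-line notation, and $\sigma[i]$ is its $i$-th entry from the left, i.e. $\sigma[i]$ is the image of $i$ under $\sigma$. A word is an element $w\in[1]\times[2]\times\cdots\times[n]$; $w[i]$ is its $i$-th letter from the left, so $1\le w[i]\le i$. Definition of $f_{1,n}$ (recursive): $f_{1,1}(1)=1$. For $n\ge 2$, let $w'$ be the word formed by the first $n-1$ letters of $w$. Then $f_{1,n}(w)$ is the one-line word obtained from the one-line word $f_{1,n-1}(w')$ by inserting $n$ so that it occupies the $w[n]$-th position counting from the right in the resulting word. (Examples for $n=3$: $112\mapsto 132$, $113\mapsto 312$, $121\mapsto 213$.) Definition of $f_{2,n}$: read $w$ backwards, for $i=n,n-1,\dots,1$, starting from the empty one-line word. At step $i$, append at the right end the $w[i]$-th smallest element of $[n]$ that has not yet been placed. The resulting one-line word is $f_{2,n}(w)$. (Examples for $n=3$: $112\mapsto 213$, $113\mapsto 312$, $121\mapsto 132$.) Both maps are bijections. *)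

(* Defs.v *)
From HB Require Import structures.
From mathcomp Require Import all_boot all_fingroup.

Set Implicit Arguments.
Unset Strict Implicit.
Unset Printing Implicit Defensive.

Definition word_pred n (w : n.-tuple nat) : bool :=
  [forall i : 'I_n, 1 <= tnth w i <= i.+1].

(** The tuple is indexed from 0, so [tnth w i] is the letter w[i+1]. *)
Record word n := Word { letters :> n.-tuple nat; _ : word_pred letters }.

HB.instance Definition _ n := [isSub for @letters n].
HB.instance Definition _ n := [Choice of word n by <:].

Definition one_line n (s : 'S_n) : seq nat := [seq (s i).+1 | i : 'I_n].

(** The default value 1 is never used for [l] a one-line word: see
    [perm_of_lineK]. *)
Definition perm_of_line n (l : seq nat) : 'S_n :=
  odflt 1%g [pick s : 'S_n | one_line s == l].

(** The entry n is put after n - w[n] entries, so that it is in position w[n]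
    from the right.  The recursion starts at n = 0, with the empty word. *)
Fixpoint f1_line (n : nat) (w : seq nat) : seq nat :=
  if n is m.+1 then
    let l := f1_line m (take m w) in
    let k := n - nth 0 w m in
    take k l ++ n :: drop k l
  else [::].

(** [f2_rec n w i placed] performs the steps i, i-1, ..., 1.  The list [free] is
    increasing, and its entry of index w[i] - 1 is the w[i]-th smallest. *)
Fixpoint f2_rec (n : nat) (w : seq nat) (i : nat) (placed : seq nat) :
    seq nat :=
  if i is j.+1 then
    let free := [seq x <- iota 1 n | x \notin placed] in
    f2_rec n w j (rcons placed (nth 0 free (nth 0 w j).-1))
  else placed.

Definition f2_line (n : nat) (w : seq nat) : seq nat := f2_rec n w n [::].

Definition f1 n (w : word n) : 'S_n := perm_of_line n (f1_line n w).

Definition f2 n (w : word n) : 'S_n := perm_of_line n (f2_line n w).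

Lemma one_line_perm n (s : 'S_n) : perm_eq (one_line s) (iota 1 n).
Proof.
apply: uniq_perm; [|exact: iota_uniq|].
  by rewrite map_inj_uniq ?enum_uniq // => i j [/val_inj/perm_inj].
move=> x; rewrite mem_iota add1n; apply/mapP/idP => [[i _ ->]|/andP[x0 xn]].
  exact: (ltn_ord (s i)).
have xn' : x.-1 < n by rewrite -ltnS prednK.
exists (s^-1%g (Ordinal xn')); first by rewrite mem_enum.
by rewrite permKV /= prednK.
Qed.

Lemma size_one_line n (s : 'S_n) : size (one_line s) = n.
Proof. by rewrite (perm_size (one_line_perm s)) size_iota. Qed.

Lemma nth_one_line n (s : 'S_n) (i : 'I_n) : nth 0 (one_line s) i = (s i).+1.
Proof.
by rewrite (nth_map i) ?nth_ord_enum // size_enum_ord.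
Qed.

Lemma one_line_inj n : injective (@one_line n).
Proof.
move=> s t est; apply/permP=> i; apply/val_inj.
by have [] : (s i).+1 = (t i).+1 by rewrite -!nth_one_line est.
Qed.

Lemma perm_of_lineK n l :
  perm_eq l (iota 1 n) -> one_line (perm_of_line n l) = l.
Proof.
move=> pl; rewrite /perm_of_line; case: pickP => [s /eqP //|no].
have sl : size l = n by rewrite (perm_size pl) size_iota.
have ul : uniq l by rewrite (perm_uniq pl) iota_uniq.
have ml (i : 'I_n) : 0 < nth 0 l i <= n.
  have : nth 0 l i \in l by rewrite mem_nth ?sl ?ltn_ord.
  by rewrite (perm_mem pl) mem_iota add1n ltnS.
have lt (i : 'I_n) : (nth 0 l i).-1 < n by case/andP: (ml i); case: (nth 0 l i).
pose g i := Ordinal (lt i).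
have gi : injective g.
  move=> i j /(congr1 val) /= e; apply/val_inj/eqP.
  rewrite -(@nth_uniq _ 0 l) ?sl ?ltn_ord //; apply/eqP.
  have /andP[i0 _] := ml i; have /andP[j0 _] := ml j.
  by rewrite -(prednK i0) e prednK.
have /eqP[] := no (perm gi).
apply: (@eq_from_nth _ 0); rewrite size_one_line ?sl // => i lin.
rewrite (nth_one_line _ (Ordinal lin)) permE /= prednK //.
by case/andP: (ml (Ordinal lin)).
Qed.

Lemma wordP n (w : word n) i : i < n -> 1 <= nth 0 w i <= i.+1.
Proof.
move=> lin; have /forallP/(_ (Ordinal lin)) := valP w.
by rewrite (tnth_nth 0).
Qed.

Lemma word_ex n (w : seq nat) :
    size w = n -> (forall i, i < n -> 1 <= nth 0 w i <= i.+1) ->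
  exists v : word n, v = w :> seq nat.
Proof.
move=> sw hw; have sw' : size w == n by apply/eqP.
have pw : word_pred (Tuple sw').
  by apply/forallP => i; rewrite (tnth_nth 0) /= hw.
by exists (Word pw).
Qed.

Lemma word_inj n (v w : word n) :
  (forall i, i < n -> nth 0 v i = nth 0 w i) -> v = w.
Proof.
move=> e; apply/val_inj/val_inj; apply: (@eq_from_nth _ 0).
  by rewrite !size_tuple.
by rewrite size_tuple => i /e.
Qed.

Lemma iota1S n : iota 1 n.+1 = iota 1 n ++ [:: n.+1].
Proof. by rewrite -(addn1 n) iotaD add1n addn1. Qed.

Lemma f1_line_perm n w : perm_eq (f1_line n w) (iota 1 n).
Proof.
elim: n w => [|n IH] w //.
rewrite [f1_line _ _]/= -cat1s perm_catCA cat_take_drop iota1S.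
by rewrite perm_catC perm_cat2r IH.
Qed.

Lemma size_f1_line n w : size (f1_line n w) = n.
Proof. by rewrite (perm_size (f1_line_perm n w)) size_iota. Qed.

Lemma one_line_f1 n (w : word n) : one_line (f1 w) = f1_line n w.
Proof. exact/perm_of_lineK/f1_line_perm. Qed.

Lemma f1_line_surj n l : perm_eq l (iota 1 n) ->
  exists w, [/\ size w = n, forall i, i < n -> 1 <= nth 0 w i <= i.+1
    & f1_line n w = l].
Proof.
elim: n l => [|n IH] l pl.
  by exists [::]; split=> //=; case: l pl => // x l /perm_size.
have nl : n.+1 \in l by rewrite (perm_mem pl) mem_iota add1n /=.
case/splitPr: nl pl => l1 l2 pl.
have pl' : perm_eq (l1 ++ l2) (iota 1 n).
  move: pl; rewrite -cat1s perm_catCA iota1S => pl.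
  by have := perm_trans pl (permEl (perm_catC _ _)); rewrite perm_cat2l.
have s12 : size l1 + size l2 = n.
  by rewrite -size_cat (perm_size pl') size_iota.
have [w [sw hw fw]] := IH _ pl'.
exists (rcons w (size l2).+1); split; first by rewrite size_rcons sw.
  move=> i; rewrite nth_rcons sw ltnS leq_eqVlt => /orP[/eqP->|lin].
    by rewrite ltnn eqxx /= ltnS -s12 leq_addl.
  by rewrite lin hw.
have tw a : take n (rcons w a) = w by rewrite -cats1 -sw take_size_cat.
rewrite /= tw fw nth_rcons sw ltnn eqxx subSS -s12 addnK.
by rewrite take_size_cat // drop_size_cat.
Qed.

Lemma f1_line_inj n v w : size v = n -> size w = n ->
    (forall i, i < n -> 1 <= nth 0 v i <= i.+1) ->
    (forall i, i < n -> 1 <= nth 0 w i <= i.+1) ->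
  f1_line n v = f1_line n w -> forall i, i < n -> nth 0 v i = nth 0 w i.
Proof.
elim: n v w => [|n IH] v w sv sw hv hw //= e i lin.
set lv := f1_line n (take n v) in e; set lw := f1_line n (take n w) in e.
have notin u : n.+1 \notin f1_line n u.
  by rewrite (perm_mem (f1_line_perm n u)) mem_iota add1n ltnn andbF.
have idx u k : k <= n ->
    index n.+1 (take k (f1_line n u) ++ n.+1 :: drop k (f1_line n u)) = k.
  move=> kn; rewrite index_cat ifN; last first.
    by apply: contra (notin u); apply: mem_take.
  by rewrite /= eqxx addn0 size_takel // size_f1_line.
have le u : 1 <= u <= n.+1 -> n.+1 - u <= n.
  by case: u => // u _; rewrite subSS leq_subr.
have ek : n.+1 - nth 0 v n = n.+1 - nth 0 w n.
  by have := congr1 (index n.+1) e; rewrite !idx ?le ?hv ?hw.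
have en : nth 0 v n = nth 0 w n.
  have /andP[_ v1] := hv n (ltnSn n); have /andP[_ w1] := hw n (ltnSn n).
  by rewrite -(subKn v1) ek subKn.
have el : lv = lw.
  move: e; rewrite ek; set k := (_ - nth 0 w n) => e.
  rewrite -(cat_take_drop k lv) -(cat_take_drop k lw).
  have st : size (take k lv) = size (take k lw).
    by rewrite !size_take !size_f1_line.
  by move/eqP: e; rewrite eqseq_cat // => /andP[/eqP-> /eqP[->]].
move: lin; rewrite ltnS leq_eqVlt => /orP[/eqP->//|lin].
have := IH _ _ _ _ _ _ el i lin.
rewrite !nth_take //; apply.
- by rewrite size_take sv ltnSn.
- by rewrite size_take sw ltnSn.
- by move=> j jn; rewrite nth_take // hv // ltnW.
- by move=> j jn; rewrite nth_take // hw // ltnW.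
Qed.

Lemma f1_inj n : injective (@f1 n).
Proof.
move=> v w /(congr1 (@one_line n)); rewrite !one_line_f1 => e.
by apply: word_inj; apply: f1_line_inj e;
  rewrite ?size_tuple // => i; apply: wordP.
Qed.

Lemma f1_surj n (s : 'S_n) : exists w : word n, f1 w == s.
Proof.
have [w [sw hw fw]] := f1_line_surj (one_line_perm s).
have [v ev] := word_ex sw hw.
by exists v; apply/eqP/one_line_inj; rewrite one_line_f1 ev.
Qed.

Lemma size_free n placed : uniq placed -> {subset placed <= iota 1 n} ->
  size [seq x <- iota 1 n | x \notin placed] = n - size placed.
Proof.
move=> up sp; have : perm_eq [seq x <- iota 1 n | x \in placed] placed.
  apply: uniq_perm => [||x]; rewrite ?filter_uniq ?iota_uniq //.
  by rewrite mem_filter andb_idr // => /sp.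
move/perm_size; rewrite !size_filter => <-.
have e := count_predC (mem placed) (iota 1 n); rewrite size_iota in e.
exact: (canRL (addKn _) e).
Qed.

Section OneStep.
Variables (n j a : nat) (placed : seq nat).
Hypotheses (up : uniq placed) (sp : {subset placed <= iota 1 n}).
Hypotheses (szp : j.+1 + size placed = n) (ha : 1 <= a <= j.+1).
Let free := [seq x <- iota 1 n | x \notin placed].
Let x := nth 0 free a.-1.

Lemma step_free : x \in free.
Proof.
rewrite mem_nth // size_free // -szp addnK.
by case: a ha.
Qed.

Lemma step_uniq : uniq (rcons placed x).
Proof.
by rewrite rcons_uniq up andbT; have := step_free; rewrite mem_filter => /andP[].
Qed.

Lemma step_sub : {subset rcons placed x <= iota 1 n}.
Proof.
move=> y; rewrite mem_rcons inE => /orP[/eqP->|/sp//].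
by have := step_free; rewrite mem_filter => /andP[].
Qed.

Lemma step_size : j + size (rcons placed x) = n.
Proof. by rewrite size_rcons addnS -addSn. Qed.
End OneStep.

Lemma f2_rec_perm n w i placed : uniq placed -> {subset placed <= iota 1 n} ->
    i + size placed = n -> (forall j, j < i -> 1 <= nth 0 w j <= j.+1) ->
  perm_eq (f2_rec n w i placed) (iota 1 n).
Proof.
elim: i placed => [|j IH] placed up sp szp hw /=.
  apply: uniq_perm; rewrite ?iota_uniq //.
  by have [] := uniq_min_size up sp; rewrite ?size_iota -?szp.
have hj := hw _ (ltnSn j).
apply: IH; [exact: step_uniq hj|exact: step_sub hj|exact: step_size|].
by move=> k kj; rewrite hw // ltnW.
Qed.

Lemma one_line_f2 n (w : word n) : one_line (f2 w) = f2_line n w.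
Proof.
apply/perm_of_lineK/f2_rec_perm => //; first by rewrite addn0.
by move=> i; apply: wordP.
Qed.

Lemma f2_rec_prefix n w i placed :
  take (size placed) (f2_rec n w i placed) = placed.
Proof.
elim: i placed => [|j IH] placed /=; first exact: take_size.
set x := nth _ _ _; have := congr1 (take (size placed)) (IH (rcons placed x)).
by rewrite size_rcons take_takel // -cats1 take_size_cat.
Qed.

Lemma f2_rec_inj n v w i placed :
    uniq placed -> {subset placed <= iota 1 n} -> i + size placed = n ->
    (forall j, j < i -> 1 <= nth 0 v j <= j.+1) ->
    (forall j, j < i -> 1 <= nth 0 w j <= j.+1) ->
    f2_rec n v i placed = f2_rec n w i placed ->
  forall j, j < i -> nth 0 v j = nth 0 w j.
Proof.
elim: i placed => [|i IH] placed up sp szp hv hw //= e j.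
have hvi := hv _ (ltnSn i); have hwi := hw _ (ltnSn i).
have szf : size [seq x <- iota 1 n | x \notin placed] = i.+1.
  by rewrite size_free // -szp addnK.
have pre x u :
    take (size placed).+1 (f2_rec n u i (rcons placed x)) = rcons placed x.
  by rewrite -(size_rcons placed x) f2_rec_prefix.
have ex := congr1 (take (size placed).+1) e; rewrite !pre in ex.
have [ex'] := rcons_inj ex.
have ei : nth 0 v i = nth 0 w i.
  move/eqP: ex'; rewrite nth_uniq ?filter_uniq ?iota_uniq // ?szf.
  - move/eqP=> ep; case/andP: hvi => v0 _; case/andP: hwi => w0 _.
    by rewrite -(prednK v0) ep prednK.
  - by case: (nth 0 v i) hvi.
  - by case: (nth 0 w i) hwi.
rewrite ltnS leq_eqVlt => /orP[/eqP->//|ji].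
apply: (IH (rcons placed _)) ji; last by rewrite -ex in e; exact: e.
- exact: step_uniq hvi.
- exact: step_sub hvi.
- exact: step_size.
- by move=> k ki; rewrite hv // ltnW.
- by move=> k ki; rewrite hw // ltnW.
Qed.

Lemma eq_f2_rec n v w i placed :
  (forall j, j < i -> nth 0 v j = nth 0 w j) ->
  f2_rec n v i placed = f2_rec n w i placed.
Proof.
elim: i placed => [|i IH] placed e //=.
by rewrite e // IH // => j ji; rewrite e // ltnW.
Qed.

Lemma f2_rec_surj n i placed rest : perm_eq (placed ++ rest) (iota 1 n) ->
    size rest = i ->
  exists w, [/\ size w = i, forall j, j < i -> 1 <= nth 0 w j <= j.+1
    & f2_rec n w i placed = placed ++ rest].
Proof.
elim: i placed rest => [|i IH] placed [|x rest] //= pp.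
  by exists [::]; split; rewrite ?cats0.
case=> sr; have := pp; rewrite -cat_rcons => pp'.
have [w [sw hw fw]] := IH _ _ pp' sr.
have := iota_uniq 1 n; rewrite -(perm_uniq pp) cat_uniq.
case/and3P=> up /hasPn dis _.
have sp : {subset placed <= iota 1 n}.
  by move=> y yp; rewrite -(perm_mem pp) mem_cat yp.
have szn : i.+1 + size placed = n.
  by have := perm_size pp; rewrite size_cat size_iota /= sr addnC.
pose free := [seq y <- iota 1 n | y \notin placed].
have xf : x \in free.
  rewrite mem_filter (dis x) ?mem_head //= -(perm_mem pp).
  by rewrite mem_cat mem_head orbT.
exists (rcons w (index x free).+1); split; first by rewrite size_rcons sw.
  move=> j; rewrite nth_rcons sw ltnS leq_eqVlt => /orP[/eqP->|ji].
    rewrite ltnn eqxx /=; have := xf; rewrite -index_mem size_free //.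
    by rewrite -szn addnK.
  by rewrite ji hw.
rewrite nth_rcons sw ltnn eqxx /= nth_index // -fw.
by apply: eq_f2_rec => j ji; rewrite nth_rcons sw ji.
Qed.

Lemma f2_inj n : injective (@f2 n).
Proof.
move=> v w /(congr1 (@one_line n)); rewrite !one_line_f2 => e.
by apply: word_inj; apply: f2_rec_inj e;
  rewrite ?addn0 // => i; apply: wordP.
Qed.

Lemma f2_surj n (s : 'S_n) : exists w : word n, f2 w == s.
Proof.
have := @f2_rec_surj n n [::] _ (one_line_perm s) (size_one_line s).
case=> w [sw hw fw]; have [v ev] := word_ex sw hw.
by exists v; apply/eqP/one_line_inj; rewrite one_line_f2 ev.
Qed.

Definition f2_inv n (s : 'S_n) : word n := xchoose (f2_surj s).

Lemma f2_invK n : cancel (@f2_inv n) (@f2 n).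
Proof. by move=> s; apply/eqP/(xchooseP (f2_surj s)). Qed.

Lemma f2K n : cancel (@f2 n) (@f2_inv n).
Proof. by move=> w; apply: f2_inj; rewrite f2_invK. Qed.

Lemma f1_bij n : bijective (@f1 n).
Proof.
exists (fun s => xchoose (f1_surj s)) => [w|s]; last first.
  exact/eqP/(xchooseP (f1_surj s)).
exact/f1_inj/eqP/(xchooseP (f1_surj (f1 w))).
Qed.

Lemma f2_bij n : bijective (@f2 n).
Proof. by exists (@f2_inv n); [exact: f2K | exact: f2_invK]. Qed.

Example f1_line_ex :
  map (f1_line 3) [:: [:: 1; 1; 2]; [:: 1; 1; 3]; [:: 1; 2; 1]]
  = [:: [:: 1; 3; 2]; [:: 3; 1; 2]; [:: 2; 1; 3]].
Proof. by []. Qed.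

Example f2_line_ex :
  map (f2_line 3) [:: [:: 1; 1; 2]; [:: 1; 1; 3]; [:: 1; 2; 1]]
  = [:: [:: 2; 1; 3]; [:: 3; 1; 2]; [:: 1; 3; 2]].
Proof. by []. Qed.

Arguments f1 n w : clear implicits.
Arguments f2 n w : clear implicits.
Arguments f2_inv n s : clear implicits.

(* Main.v *)
Require Import Defs.
From mathcomp Require Import all_boot all_fingroup.

(** Both maps decode inversion tables.  If f1 w = s, then w[v] - 1 is the number
    of entries smaller than v to the right of v in the one-line word of s
    ([f1_line_code]): it is fixed when v is inserted, and the later insertions
    only bring in larger entries.  If f2 w = t, then w[j] - 1 is the number of
    entries smaller than y to the right of y, for the entry y in the j-th
    position from the right ([f2_line_code]): the elements not yet placed are
    exactly those that end up to the right.  So f1 counts inversions by their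
    larger value and f2 by their left position.

    Taking the inverse exchanges values with positions, and the reverse
    complement, i.e. conjugation by the order-reversing permutation, turns
    positions from the left into positions from the right.  Hence the first
    table of [revcomp_inv t], the inverse of the reverse complement of t, is the
    second table of t ([value_code_revcomp_inv]).  As every permutation is some
    f1 v and its table determines v, this gives f1 w = revcomp_inv (f2 w)
    ([f1_f2]), so f1 composed with the inverse of f2 is [revcomp_inv], an
    involution because inversion and conjugation by an involution commute. *)

Set Implicit Arguments.
Unset Strict Implicit.
Unset Printing Implicit Defensive.

Definition smaller_right (x : nat) (l : seq nat) : nat :=
  count (ltn^~ x) (drop (index x l) l).

Lemma smaller_right_insert x y l1 l2 : x < y ->
  smaller_right x (l1 ++ y :: l2) = smaller_right x (l1 ++ l2).
Proof.
move=> xy; rewrite /smaller_right.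
elim: l1 => [|z l1 IH] /=; first by rewrite gtn_eqF.
case: eqP => [_|_]; last exact: IH.
have yx : (y < x) = false by rewrite ltnNge ltnW.
by rewrite /= !count_cat /= yx.
Qed.

Lemma smaller_right_nth l p : uniq l -> p < size l ->
  smaller_right (nth 0 l p) l = count (ltn^~ (nth 0 l p)) (drop p l).
Proof. by move=> ul pl; rewrite /smaller_right index_uniq. Qed.

Lemma count_ltn_nth s a : sorted ltn s -> a < size s ->
  count (ltn^~ (nth 0 s a)) s = a.
Proof.
elim: s a => // x s IH [|a] /= ps.
  rewrite ltnn => _; apply/eqP; rewrite add0n -leqn0 leqNgt -has_count.
  apply/hasPn => y ys; rewrite -leqNgt ltnW //.
  exact: (allP (order_path_min ltn_trans ps)).
rewrite ltnS => sa; rewrite (IH _ (path_sorted ps)) //.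
by rewrite (allP (order_path_min ltn_trans ps)) // mem_nth.
Qed.

(** The letter w[n] counts positions from the right, so w[n] - 1 entries follow n
    when it is inserted, all of them smaller; inserting a larger entry changes no
    earlier count. *)
Lemma f1_line_code n w i : i < n -> 1 <= nth 0 w i <= i.+1 ->
  nth 0 w i = (smaller_right i.+1 (f1_line n w)).+1.
Proof.
elim: n w => [|n IH] w //; rewrite ltnS leq_eqVlt => /orP[/eqP->|lin] hw /=.
  set l := f1_line n _; set k := n.+1 - _.
  have kn : k <= n by rewrite leq_subCl subSnn; case/andP: hw.
  have nl : n.+1 \notin l.
    by rewrite (perm_mem (f1_line_perm _ _)) mem_iota add1n ltnn andbF.
  have st : size (take k l) = k by rewrite size_takel // size_f1_line.
  rewrite /smaller_right index_cat ifN; last exact: contra (@mem_take _ _ _ _) nl.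
  rewrite /= eqxx addn0 drop_size_cat //= ltnn add0n.
  have /eqP -> : count (ltn^~ n.+1) (drop k l) == size (drop k l).
    rewrite -all_count; apply/allP => y /mem_drop.
    by rewrite (perm_mem (f1_line_perm _ _)) mem_iota add1n => /andP[].
  by rewrite size_drop size_f1_line -subSn // /k subKn //; case/andP: hw.
by rewrite smaller_right_insert ?ltnS // cat_take_drop -IH // nth_take.
Qed.

(** The entries that [f2_rec] places from now on are the free ones, so the rank
    of the next entry among the free ones counts the smaller entries that end
    up to its right. *)
Lemma f2_rec_code n w i placed :
    uniq placed -> {subset placed <= iota 1 n} -> i + size placed = n ->
    (forall j, j < i -> 1 <= nth 0 w j <= j.+1) ->
  forall j, j < i -> nth 0 w j =
    (smaller_right (nth 0 (f2_rec n w i placed) (n - j.+1))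
                   (f2_rec n w i placed)).+1.
Proof.
elim: i placed => [|i IH] placed up sp szp hw //= j.
have hi := hw _ (ltnSn i).
have up' := step_uniq up sp szp hi; have sp' := step_sub up sp szp hi.
have szp' := step_size (nth 0 w i) szp.
have hw' k : k < i -> 1 <= nth 0 w k <= k.+1 by move=> ki; rewrite hw // ltnW.
rewrite ltnS leq_eqVlt => /orP[/eqP->|ji]; last exact: IH.
have szf := size_free up sp; rewrite -{2}szp addnK in szf.
set free := [seq x <- _ | _] in up' sp' szp' szf *.
set x := nth 0 free _ in up' sp' szp' *; set l := f2_rec _ _ _ _.
have pl : perm_eq l (iota 1 n) by apply: f2_rec_perm.
have ul : uniq l by rewrite (perm_uniq pl) iota_uniq.
have tl : take (size placed) l = placed.
  rewrite -(@take_takel _ _ (size placed).+1) // -(size_rcons placed x).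
  by rewrite f2_rec_prefix -cats1 take_size_cat.
have -> : n - i.+1 = size placed by rewrite -szp addKn.
have sl : size placed < size l.
  by rewrite (perm_size pl) size_iota -szp addSn ltnS leq_addl.
have xl : nth 0 l (size placed) = x.
  rewrite -(@nth_take (size placed).+1) // -(size_rcons placed x).
  by rewrite f2_rec_prefix nth_rcons ltnn eqxx.
rewrite smaller_right_nth // xl.
set r := drop _ l; have lE : l = placed ++ r by rewrite -tl cat_take_drop.
(* The free elements are the entries still to come, in increasing order. *)
have pf : perm_eq r free.
  apply: uniq_perm; rewrite ?drop_uniq ?filter_uniq ?iota_uniq // => y.
  rewrite mem_filter -(perm_mem pl) lE mem_cat; case yp: (y \in placed) => //=.
  move: ul; rewrite lE cat_uniq => /and3P[_ /hasPn dis _].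
  by apply: contraTF yp; apply: dis.
rewrite (seq.permP pf) count_ltn_nth ?szf; first by case: (nth 0 w i) hi.
  exact: sorted_filter ltn_trans _ _ (iota_ltn_sorted _ _).
by case: (nth 0 w i) hi.
Qed.

Lemma f2_line_code n (w : word n) j : j < n ->
  nth 0 w j =
  (smaller_right (nth 0 (f2_line n w) (n - j.+1)) (f2_line n w)).+1.
Proof.
by move=> jn; apply: f2_rec_code; rewrite ?addn0 // => k; apply: wordP.
Qed.

Lemma smaller_right_one_line n (s : 'S_n) (i : 'I_n) :
  smaller_right (s i).+1 (one_line s) = #|[set k : 'I_n | i < k & s k < s i]|.
Proof.
rewrite -nth_one_line smaller_right_nth ?size_one_line //; last first.
  by rewrite (perm_uniq (one_line_perm s)) iota_uniq.
have -> : drop i (one_line s) = [seq (s k).+1 | k : 'I_n <- enum 'I_n & i <= k].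
  rewrite /one_line -map_drop; congr map.
  apply: (inj_map val_inj); rewrite map_drop.
  rewrite -(filter_map val (leq i)) val_enum_ord drop_iota add0n.
  apply: (irr_sorted_eq ltn_trans ltnn); first exact: iota_ltn_sorted.
    exact: sorted_filter ltn_trans _ _ (iota_ltn_sorted _ _).
  move=> k; rewrite mem_filter !mem_iota /= add0n subnKC //.
  exact: ltnW.
rewrite nth_one_line count_map -size_filter cardE.
apply/perm_size/uniq_perm => [||k]; rewrite ?(enum_uniq, filter_uniq) //.
rewrite 2!mem_filter !mem_enum !inE /= andbT ltnS andbC.
by case: (ltngtP i k) => //= /val_inj ->; rewrite ltnn.
Qed.

Definition rev_perm n : 'S_n := perm (@rev_ord_inj n).

Lemma rev_permK n : (rev_perm n * rev_perm n = 1)%g.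
Proof. by apply/permP => i; rewrite permM !permE rev_ordK. Qed.

Definition revcomp_inv n (t : 'S_n) : 'S_n := ((t ^ rev_perm n)^-1)%g.

Lemma revcomp_invK n : involutive (@revcomp_inv n).
Proof. by move=> t; rewrite /revcomp_inv conjVg invgK -conjgM rev_permK conjg1. Qed.

Lemma revcomp_invV n (t : 'S_n) i :
  ((revcomp_inv t)^-1)%g i = rev_ord (t (rev_ord i)).
Proof.
have rV : ((rev_perm n)^-1 = rev_perm n)%g.
  by apply: (mulgI (rev_perm n)); rewrite mulgV rev_permK.
by rewrite /revcomp_inv invgK conjgE rV !permM !permE.
Qed.

Lemma ltn_rev_ord n (i j : 'I_n) : (rev_ord i < rev_ord j) = (j < i).
Proof. by rewrite /= ltn_sub2lE // ltnS. Qed.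

(** The bijection sending k to rev_ord (t k), from the positions of [t] to those
    of [revcomp_inv t], matches the inversions counted on the two sides: position
    order in [t] becomes reversed value order, and value order reversed position
    order. *)
Lemma value_code_revcomp_inv n (t : 'S_n) (v : 'I_n) :
  smaller_right v.+1 (one_line (revcomp_inv t)) =
  smaller_right (t (rev_ord v)).+1 (one_line t).
Proof.
set s := revcomp_inv t.
have sE i : s (rev_ord (t i)) = rev_ord i.
  by apply: (can_inj (permK s^-1)); rewrite ?permK revcomp_invV rev_ordK.
(* Write v as the value of s at the position rev_ord (t (rev_ord v)). *)
rewrite -[v in LHS]rev_ordK -sE !smaller_right_one_line sE rev_ordK.
have f_bij : bijective (fun k => rev_ord (t k)).
  exact: bij_comp (inv_bij (@rev_ordK n)) (Bijective (permK t) (permKV t)).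
rewrite -(on_card_preimset (onW_bij _ f_bij)).
apply: eq_card => k; rewrite !inE sE !ltn_rev_ord andbC.
by congr andb; rewrite -[v in LHS]rev_ordK; exact: ltn_rev_ord.
Qed.

(** The permutation [revcomp_inv (f2 w)] is [f1 v] for some word [v]; comparing
    tables shows that [v] is [w]. *)
Lemma f1_f2 n (w : word n) : f1 n w = revcomp_inv (f2 n w).
Proof.
have [v /eqP fv] := f1_surj (revcomp_inv (f2 n w)).
rewrite -fv; congr f1; apply: word_inj => j jn.
rewrite (f1_line_code jn (wordP v jn)) (f2_line_code _ jn).
rewrite -one_line_f1 -one_line_f2 fv (value_code_revcomp_inv _ (Ordinal jn)).
by rewrite -nth_one_line.
Qed.

Theorem theorem2 (n : nat) (n_ge1 : 1 <= n) :
  f1 n \o f2_inv n \o f1 n \o f2_inv n =1 @id 'S_n.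
Proof.
by move=> s; rewrite /= !f1_f2 !f2_invK revcomp_invK.
Qed.
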